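(* For every integer $m\ge 1$ there exist constants $A\ge B>1$ such that all orbital Schreier graphs $\Gamma_w(\mathsf A_{0^m})$, $w\in\{0,1\}^{\omega}$, have intermediate growth between $A^{(\log n)^{m+1}}$ and $B^{(\log n)^{m+1}}$; that is, the growth function $\gamma$ of each such graph satisfies $B^{(\log n)^{m+1}}\prec\gamma(n)\prec A^{(\log n)^{m+1}}$ and is superpolynomial and subexponential.
   Context: The automaton $\mathsf A_{0^m}$. Let $X=\{0,1\}$ and let $X^{\omega}$ be the set of right-infinite sequences over $X$. The automaton $\mathsf A_{0^m}$ has states $e,a=a_0,a_1,\dots,a_m$, acting as the following invertible transformations of $X^{\omega}$ (for all $w\in X^{\omega}$): $e(w)=w$; $a(0w)=1w$ and $a(1w)=0\,a(w)$ (the binary adding machine); and for $1\le i\le m$, $a_i(0w)=0\,a_i(w)$ and $a_i(1w)=1\,a_{i-1}(w)$. Schreier graphs. Let $G$ be the group of transformations of $X^{\omega}$ generated by $S=\{a_0,a_1,\dots,a_m\}$. For $w\in X^{\omega}$, $\Gamma_w(\mathsf A_{0^m})$ is the graph with vertex set the orbit $G(w)$, in which $u,v$ are adjacent iff $s(v)=u$ for some $s\in S\cup S^{-1}$. Growth. The growth function $\gamma_v(n)$ of a connected locally finite graph with respect to a vertex $v$ is the number of vertices in the closed ball of radius $n$ centered at $v$. Write $f\prec g$ ($f$ has growth not greater than $g$) if there is a constant $C>0$ with $f(n)\le g(Cn)$ for all $n\in\mathbb N$; $f\sim g$ (equivalent) if $f\prec g$ and $g\prec f$. The growth functions with respect to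 different vertices are equivalent, so one speaks of the growth of the graph. The growth is subexponential if it is not greater than $a^n$ ($a>1$) and not equivalent to it; superpolynomial if it is greater than every polynomial function (in the order $\prec$); intermediate if it is both superpolynomial and subexponential. Logarithms are to base $2$, with the convention $\log 0=\log 1=1$. *)

(* Defs.v *)
From mathcomp Require Import all_boot all_order all_algebra finmap.
From mathcomp Require Import all_classical all_reals all_analysis.

Set Implicit Arguments.
Unset Strict Implicit.
Unset Printing Implicit Defensive.

Import Order.TTheory GRing.Theory Num.Theory.

Local Open Scope classical_set_scope.
Local Open Scope ring_scope.

(* [false] is the letter 0, [true] is the letter 1. *)
Notation word := (nat -> bool).

Definition wcons (x : bool) (w : word) : word :=
  fun n => if n is k.+1 then w k else x.

(* The automaton A_{0^m}, as a Mealy machine: [None] is e, [Some i] is a_i.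
   In state q, the word x w is sent to the letter [output q x] followed by the
   image of w under [next_state q x]; see [act_wcons]. *)
Definition state (m : nat) := option 'I_m.+1.

Definition output (m : nat) (q : state m) (x : bool) : bool :=
  if q is Some i then if i == ord0 then ~~ x else x else x.

Definition next_state (m : nat) (q : state m) (x : bool) : state m :=
  if q is Some i then
    if i == ord0 then (if x then Some ord0 else None)
    else (if x then Some (inord i.-1) else Some i)
  else None.

Fixpoint run (m : nat) (q : state m) (w : word) (n : nat) : state m :=
  if n is k.+1 then next_state (run q w k) (w k) else q.

Definition act (m : nat) (q : state m) (w : word) : word :=
  fun n => output (run q w n) (w n).

Definition a_ (m : nat) (i : 'I_m.+1) : word -> word := act (Some i).

Definition generators (m : nat) : set (word -> word) := range (@a_ m).

Definition inverses (T : Type) (S : set (T -> T)) : set (T -> T) :=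
  [set h | exists2 s, S s & cancel s h /\ cancel h s].

Inductive generated (T : Type) (S : set (T -> T)) : set (T -> T) :=
| generated_id : generated S id
| generated_gen s : S s -> generated S s
| generated_comp g h : generated S g -> generated S h -> generated S (g \o h)
| generated_inv g h :
    generated S g -> cancel g h -> cancel h g -> generated S h.

Definition orbit_of (T : Type) (G : set (T -> T)) (x : T) : set T :=
  [set y | exists2 g, G g & g x = y].

Record graph (T : Type) := Graph {
  vertices : set T;
  adjacent : T -> T -> Prop }.

Definition schreier (m : nat) (w : word) : graph word :=
  {| vertices := orbit_of (generated (@generators m)) w;
     adjacent := fun u v =>
       exists2 s, (@generators m `|` inverses (@generators m)) s & s v = u |}.

(* The ball is the set of endpoints of walks of length at most n from v
   staying in the vertex set. *)
Definition closed_ball_graph (T : Type) (Y : graph T) (v : T) (n : nat) :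
    set T :=
  [set u | exists p : seq T,
    [/\ path (fun x y => `[< adjacent Y x y >]) v p,
        (forall i, (i <= size p)%N -> vertices Y (nth v (v :: p) i)),
        last v p = u & (size p <= n)%N]].

(* [fset_set] is empty on infinite sets; in the graphs above all balls are
   finite, see [finite_ball_schreier]. *)
Definition growth_function (T : choiceType) (Y : graph T) (v : T) (n : nat) :
    nat :=
  #|` fset_set (closed_ball_graph Y v n)|%N.

Section GrowthOrder.
Variable R : realType.
Implicit Types f g : nat -> R.

(* n ranges over the positive integers: at n = 0 no rescaling of the argument
   can compensate for f 0 > g 0, e.g. for a constant polynomial f = 2 and a
   growth function g, for which g 0 = 1. The constant is an integer because
   the functions compared are defined on integers only. *)
Definition growth_le f g : Prop :=
  exists2 C : nat, (0 < C)%N & forall n : nat, (0 < n)%N -> f n <= g (C * n)%N.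

Definition growth_equiv f g : Prop := growth_le f g /\ growth_le g f.

Definition growth_lt f g : Prop := growth_le f g /\ ~ growth_equiv f g.

Definition subexponential f : Prop :=
  forall a : R, 1 < a -> growth_lt f (fun n => a ^+ n).

Definition superpolynomial f : Prop :=
  forall p : {poly R}, growth_lt (fun n => p.[n%:R]) f.

Definition intermediate f : Prop := superpolynomial f /\ subexponential f.

(* Base 2 logarithm, with the convention log 0 = log 1 = 1. *)
Definition log2 (n : nat) : R := if (n <= 1)%N then 1 else ln n%:R / ln 2.

Definition explog (A : R) (m n : nat) : R := A `^ (log2 n ^+ m.+1).

End GrowthOrder.

Lemma act_wcons (m : nat) (q : state m) x w :
  act q (wcons x w) = wcons (output q x) (act (next_state q x) w).
Proof.
apply/funext => -[|n] //=.
rewrite /act /=; congr output.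
by elim: n => //= n ->.
Qed.

Lemma act_e (m : nat) (w : word) : act (None : state m) w = w.
Proof.
have H n : run (None : state m) w n = None by elim: n => //= n ->.
by apply/funext => n; rewrite /act H.
Qed.

Lemma a0_0 (m : nat) (w : word) :
  a_ (ord0 : 'I_m.+1) (wcons false w) = wcons true w.
Proof. by rewrite /a_ act_wcons /= act_e. Qed.

Lemma a0_1 (m : nat) (w : word) :
  a_ (ord0 : 'I_m.+1) (wcons true w) = wcons false (a_ (ord0 : 'I_m.+1) w).
Proof. by rewrite /a_ act_wcons. Qed.

Lemma ai_0 (m : nat) (i : 'I_m.+1) (w : word) : (0 < i)%N ->
  a_ i (wcons false w) = wcons false (a_ i w).
Proof.
by move=> i0; rewrite /a_ act_wcons /= -val_eqE /= (gtn_eqF i0).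
Qed.

Lemma ai_1 (m : nat) (i j : 'I_m.+1) (w : word) : i = j.+1 :> nat ->
  a_ i (wcons true w) = wcons true (a_ j w).
Proof.
by move=> ij; rewrite /a_ act_wcons /= -val_eqE /= ij /= inord_val.
Qed.

Lemma act_inj (m : nat) (q : state m) : injective (act q).
Proof.
move=> u v uv.
have out_inj (r : state m) : injective (output r).
  by case: r => [i|] [] [] //=; case: ifP.
suff H n : run q u n = run q v n /\ (forall k, (k < n)%N -> u k = v k).
  by apply/funext => n; have [_] := H n.+1; exact.
elim: n => [//|n [r IH]].
have un : u n = v n.
  by apply: (out_inj (run q u n)); rewrite {2}r; exact: (congr1 (@^~ n) uv).
split => /=; first by rewrite r un.
by move=> k; rewrite ltnS leq_eqVlt => /predU1P[->|/IH].
Qed.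

Fixpoint unrun (m : nat) (q : state m) (w : word) (n : nat) : state m :=
  if n is k.+1 then next_state (unrun q w k) (output (unrun q w k) (w k)) else q.

Definition unact (m : nat) (q : state m) (w : word) : word :=
  fun n => output (unrun q w n) (w n).

Lemma unactK (m : nat) (q : state m) : cancel (unact q) (act q).
Proof.
move=> w; have H n : run q (unact q w) n = unrun q w n by elim: n => //= n ->.
apply/funext => n; rewrite /act H /unact.
by case: (unrun q w n) => [i|] //=; case: (i == ord0); rewrite ?negbK.
Qed.

Lemma actK (m : nat) (q : state m) : cancel (act q) (unact q).
Proof. by move=> w; apply: (@act_inj _ q); rewrite unactK. Qed.

Lemma schreier_adjacentP (m : nat) (w u v : word) :
  adjacent (schreier m w) u v <->
  exists i : 'I_m.+1, a_ i v = u \/ unact (Some i) v = u.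
Proof.
split=> [[s [[i _ <-] su|[_ [i _ <-] [K1 K2]] su]]|[i [E|E]]].
- by exists i; left.
- exists i; right; rewrite -su; apply: (@act_inj _ (Some i)).
  by rewrite unactK; exact/esym/K2.
- by exists (a_ i) => //; left; exists i.
- exists (unact (Some i)) => //; right; exists (a_ i); first by exists i.
  by split; [exact: actK|exact: unactK].
Qed.

Lemma finite_ball_schreier (m : nat) (w v : word) (n : nat) :
  finite_set (closed_ball_graph (schreier m w) v n).
Proof.
pose N (x : word) : set word :=
  range (fun i : 'I_m.+1 => a_ i x) `|`
  range (fun i : 'I_m.+1 => unact (Some i) x).
have finN x : finite_set (N x).
  by rewrite finite_setU; split; exact: finite_image.
have subN x y : adjacent (schreier m w) x y -> N x y.
  move=> /schreier_adjacentP[i [E|E]].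
    by right; exists i => //; rewrite -E; exact: actK.
  by left; exists i => //; rewrite -E; exact: unactK.
elim: n v => [|n IH] v.
  apply: (@sub_finite_set _ _ [set v]); last exact: finite_set1.
  by move=> u [[|y p] [_ _ <- sz]] /=.
apply: (@sub_finite_set _ _
  ([set v] `|` \bigcup_(y in N v) closed_ball_graph (schreier m w) y n)).
  move=> u [[|y p] /= [pth V <- sz]]; first by left.
  move: pth => /andP[/asboolP vy pth].
  right; exists y; first exact: subN.
  exists p; split=> // i ip.
  have := V i.+1 ip; rewrite /= (set_nth_default v y) //.
by rewrite finite_setU; split => //; exact: bigcup_finite.
Qed.

(* Main.v *)
(* The generator a_0 adds 1 to a 2-adic integer, and a_i adds 1 to the part of
   a word lying beyond its i-th letter 1.

   Upper bound. Away from the prefix 0^k, the moves of degree m+1 act on the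
   tail as moves of degree at most m. If k is so large that every loop of length
   at most n at the prefix 0^k acts on the tail as a walk in a_1, ..., a_(m+1)
   ("tame"), then a walk of length n is, on the tail, a walk of degree m up to
   its first visit to 0^k, a walk in a_1, ..., a_(m+1) up to the last visit, and
   a walk of degree m again; as a_1, ..., a_(m+1) act beyond the first 1 as
   a_0, ..., a_m, the ball sizes satisfy f_(m+1)(n) <= 2^k f_m(n)^3. A tame k for
   n and degree m+1 plus a tame j for 2n and degree m is tame for 2n and degree
   m+1, so that k = (s+1)^(m+1) is tame for n = 2^s and degree m.

   Lower bound. To move between two words of length k+j, bring the prefix of
   length k to 0^(k-1)1, correct the tail with a_1, ..., a_(m+1), and then set
   the prefix. Hence the diameters satisfy D_(m+1)(k+j) <= 2 D_(m+1)(k) + D_m(j),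
   and D_m(s^(m+1)) <= 2^((m+1)(s+1)). *)

Require Import Defs.
From mathcomp Require Import all_boot all_order all_algebra.
From mathcomp Require Import all_classical all_reals all_analysis.
From mathcomp Require Import finmap zify lra.

Set Implicit Arguments.
Unset Strict Implicit.
Unset Printing Implicit Defensive.

Import Order.TTheory GRing.Theory Num.Theory.

Local Open Scope classical_set_scope.
Local Open Scope ring_scope.

(** * Walks and words *)

Section Schreier.
Local Open Scope nat_scope.

Section Walk.
Variable T : Type.
Implicit Types (r : T -> T -> Prop) (x y z : T).

Fixpoint walk r n x z : Prop :=
  if n is n'.+1 then exists2 y, r x y & walk r n' y z else x = z.

Lemma walk1 r x y : r x y -> walk r 1 x y.
Proof. by move=> rxy; exists y. Qed.

Lemma walk_cat r n1 n2 x y z :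
  walk r n1 x y -> walk r n2 y z -> walk r (n1 + n2) x z.
Proof.
elim: n1 x => [x -> //|n IH x [y' xy' yy'] yz].
by rewrite addSn; exists y' => //; apply: IH.
Qed.

Lemma walk_split r n1 n2 x z : walk r (n1 + n2) x z ->
  exists2 y, walk r n1 x y & walk r n2 y z.
Proof.
elim: n1 x => [x xz|n IH x]; first by exists x.
by rewrite addSn => -[y' xy' /IH[y y'y yz]]; exists y => //; exists y'.
Qed.

Lemma walk_refl r n x : (forall y, r y y) -> walk r n x x.
Proof. by move=> rr; elim: n => //= n IH; exists x. Qed.

Lemma walk_leq r n1 n2 x z : (forall y, r y y) -> n1 <= n2 ->
  walk r n1 x z -> walk r n2 x z.
Proof.
move=> rr /subnKC <- xz; apply: walk_cat xz _.
exact: walk_refl.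
Qed.

Lemma walk_sym r n x z : (forall u v, r u v -> r v u) ->
  walk r n x z -> walk r n z x.
Proof.
move=> rs; elim: n x => [x -> //|n IH x [y xy /IH yz]].
by rewrite -addn1; apply: walk_cat yz _; apply: walk1; apply: rs.
Qed.

Lemma walk_sub r r' n x z : (forall u v, r u v -> r' u v) ->
  walk r n x z -> walk r' n x z.
Proof.
move=> rr'; elim: n x => [//|n IH x [y xy /IH yz]].
by exists y => //; apply: rr'.
Qed.

End Walk.

Lemma walk_map T T' (r : T -> T -> Prop) (r' : T' -> T' -> Prop)
    (f : T -> T') n x z :
  (forall u v, r u v -> r' (f u) (f v)) ->
  walk r n x z -> walk r' n (f x) (f z).
Proof.
move=> rr'; elim: n x => [x ->//|n IH x [y xy /IH yz]].
by exists (f y) => //; apply: rr'.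
Qed.

Definition wapp (v : seq bool) (y : word) : word := foldr wcons y v.

Lemma wcons_inj c c' (y y' : word) :
  wcons c y = wcons c' y' -> c = c' /\ y = y'.
Proof.
move=> E; split; first by have := congr1 (@^~ 0) E.
by apply/funext => n; have := congr1 (@^~ n.+1) E.
Qed.

Lemma wappE k (x : word) : exists v y, size v = k /\ x = wapp v y.
Proof.
elim: k x => [|k IH] x; first by exists [::], x.
have [v [y [sv E]]] := IH (fun n => x n.+1).
exists (x 0 :: v), y; split; first by rewrite /= sv.
by rewrite /= -E; apply/funext => -[].
Qed.

Lemma wapp_inj v v' y y' : size v = size v' ->
  wapp v y = wapp v' y' -> v = v' /\ y = y'.
Proof.
elim: v v' => [|c v IH] [|c' v'] //= [sv] /wcons_inj[-> /(IH _ sv)[-> ->]].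
by [].
Qed.

Lemma wapp_cat v v' y : wapp (v ++ v') y = wapp v (wapp v' y).
Proof. exact: foldr_cat. Qed.

Definition zeros k : seq bool := nseq k false.

Lemma size_zeros k : size (zeros k) = k. Proof. exact: size_nseq. Qed.

Lemma zeros_cat k j : zeros (k + j) = zeros k ++ zeros j.
Proof. exact: nseqD. Qed.

(* The generator a_i, independently of the bound m on the indices: [st i x n]
   is the state reached after reading n letters, [None] being e. *)
Fixpoint st (i : nat) (x : word) (n : nat) : option nat :=
  if n is k.+1 then
    match st i x k with
    | Some 0 => if x k then Some 0 else None
    | Some j.+1 => Some (if x k then j else j.+1)
    | None => None
    end
  else Some i.

Definition gen (i : nat) (x : word) : word :=
  fun n => x n (+) (st i x n == Some 0).

(** Indices only decrease along a run, so [inord] never truncates and all degrees [m] share the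
    transformations [gen i]. *)
Lemma a_gen m (i : 'I_m.+1) : a_ i = gen i.
Proof.
apply/funext => x; apply/funext => n; rewrite /a_ /act /gen.
have -> : st i x n = omap val (run (Some i) x n).
  elim: n => //= n ->; case: (run _ _ _) => //= j.
  have [->|j0] := eqVneq j ord0; first by case: (x n).
  have : val j != 0 by [].
  case E : (val j) => [//|j'] _; case: (x n); rewrite /= ?E //.
  rewrite inordK // ltnS.
  by have := ltn_ord j; rewrite [nat_of_ord j]E => /ltnW.
case: (run _ _ _) => [j|] /=; last by rewrite addbF.
by rewrite -val_eqE /=; case: (val j); case: (x n).
Qed.

(** [st] recurses on the last letter read; self-similarity needs the recursion on the first one. *)
Lemma st_next i x n : st i x n.+1 =
  (if i is j.+1 then st (if x 0 then j else i) (fun k => x k.+1) n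
   else if x 0 then st 0 (fun k => x k.+1) n else None).
Proof.
elim: n => [|n IH]; first by case: i.
rewrite [LHS]/=; move: IH => /= ->.
by case: i => [|i]; case: (x 0).
Qed.

Lemma gen0_0 w : gen 0 (wcons false w) = wcons true w.
Proof.
apply/funext => -[|n] //; rewrite /gen st_next /=.
by rewrite addbF.
Qed.

Lemma gen0_1 w : gen 0 (wcons true w) = wcons false (gen 0 w).
Proof. by apply/funext => -[|n] //; rewrite /gen st_next. Qed.

Lemma genS_0 i w : gen i.+1 (wcons false w) = wcons false (gen i.+1 w).
Proof. by apply/funext => -[|n] //; rewrite /gen st_next. Qed.

Lemma genS_1 i w : gen i.+1 (wcons true w) = wcons true (gen i w).
Proof. by apply/funext => -[|n] //; rewrite /gen st_next. Qed.

Lemma genS_zeros i k y :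
  gen i.+1 (wapp (zeros k) y) = wapp (zeros k) (gen i.+1 y).
Proof. by elim: k => //= k IH; rewrite genS_0 IH. Qed.

(** * Action of generators and walks on the tail behind a prefix *)

Lemma gen0_section v v' y y' : size v = size v' ->
  gen 0 (wapp v y) = wapp v' y' -> y' = y \/ y' = gen 0 y.
Proof.
elim: v v' => [|c v IH] [|c' v'] //=; first by right.
move=> [sv]; case: c.
  by rewrite gen0_1 => /wcons_inj[_ /(IH _ sv)].
by rewrite gen0_0 => /wcons_inj[_ /(wapp_inj sv)[_ ->]]; left.
Qed.

Lemma gen_section i v v' y y' : size v = size v' ->
  gen i (wapp v y) = wapp v' y' ->
  y' = y \/ exists2 j, j <= i & y' = gen j y.
Proof.
elim: v v' i => [|c v IH] [|c' v'] i //=; first by right; exists i.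
case: i => [|i] sv.
  move=> /(gen0_section (v := c :: v) (v' := c' :: v') sv)[]->; first by left.
  by right; exists 0.
case: sv => sv; case: c.
  rewrite genS_1 => /wcons_inj[_ /(IH _ _ sv)[->|[j ji ->]]]; first by left.
  by right; exists j => //; apply: leqW.
by rewrite genS_0 => /wcons_inj[_ /(IH _ _ sv)].
Qed.

(** For i > 0 the index stays i only while zeros are read, and these are kept; a prefix other than
    0^k on either side thus forces it down. The disjunction serves inverse generators, which start
    from the prefix [v']. *)
Lemma gen_section_neq i v v' y y' : size v = size v' ->
  v != zeros (size v) \/ v' != zeros (size v) ->
  gen i (wapp v y) = wapp v' y' ->
  y' = y \/ exists2 j, j <= i.-1 & y' = gen j y.
Proof.
elim: v v' i => [|c v IH] [|c' v'] i //=; first by move=> _ [].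
case: i => [|i] sv.
  move=> _ /(gen0_section (v := c :: v) (v' := c' :: v') sv)[]->; first by left.
  by right; exists 0.
case: sv => sv; case: c.
  by rewrite genS_1 => _ /wcons_inj[_ /(gen_section sv)].
rewrite genS_0 => N /wcons_inj[cE /(IH _ _ sv)]; apply.
by move: N; rewrite -cE !eqseq_cons.
Qed.

(** Equality is allowed so that walks of length exactly n reach the whole ball of radius n. *)
Definition step m (x y : word) : Prop :=
  x = y \/ exists2 i, i <= m & gen i x = y \/ gen i y = x.

(* The moves that fix the prefix 0^k, for every k. *)
Definition pstep m (x y : word) : Prop :=
  x = y \/ exists2 i, i < m & gen i.+1 x = y \/ gen i.+1 y = x.

Lemma step_refl m x : step m x x. Proof. by left. Qed.
Lemma pstep_refl m x : pstep m x x. Proof. by left. Qed.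

Lemma step_sym m x y : step m x y -> step m y x.
Proof. by case=> [->|[i im [E|E]]]; [left|right; exists i; auto..]. Qed.

Lemma pstep_sym m x y : pstep m x y -> pstep m y x.
Proof. by case=> [->|[i im [E|E]]]; [left|right; exists i; auto..]. Qed.

Lemma pstepW m x y : pstep m x y -> pstep m.+1 x y.
Proof. by case=> [->|[i im E]]; [left|right; exists i => //; apply: leqW]. Qed.

Lemma pstep_zeros m k y z : pstep m (wapp (zeros k) y) z ->
  exists2 y', z = wapp (zeros k) y' & pstep m y y'.
Proof.
case=> [<-|[i im [<-|E]]].
- by exists y => //; left.
- by exists (gen i.+1 y); rewrite ?genS_zeros//; right; exists i; auto.
have [v [y' [sv zE]]] := wappE k z; rewrite zE in E *.
have {sv} : size v = size (zeros k) by rewrite size_zeros.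
have [vz|vN] := eqVneq v (zeros k) => sv.
  move: E; rewrite vz genS_zeros => /(wapp_inj erefl)[_ <-].
  by exists y' => //; right; exists i; auto.
(* A prefix other than 0^k is never sent to 0^k, since a_(i+1) copies all letters up to and
   including the first 1. *)
exfalso; move: E vN sv; clear; elim: k v => [[]//|k IH] [//|c v] E vN [sv].
move: E; case: c vN => vN /=; first by rewrite genS_1 => /wcons_inj[].
by rewrite genS_0 => /wcons_inj[_ /IH]; apply.
Qed.

Lemma walk_pstep_zeros m n k y z : walk (pstep m) n (wapp (zeros k) y) z ->
  exists2 y', z = wapp (zeros k) y' & walk (pstep m) n y y'.
Proof.
elim: n y => [y <-|n IH y [x /pstep_zeros[y1 -> yy1] /IH[y' -> y1y']]].
  by exists y.
by exists y' => //; exists y1.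
Qed.

Lemma step_section m v v' y y' : size v = size v' -> v != zeros (size v) ->
  step m.+1 (wapp v y) (wapp v' y') -> step m y y'.
Proof.
move=> sv vN [/(wapp_inj sv)[_ ->]|[i im [E|E]]]; first by left.
  have [->|[j ji ->]] := gen_section_neq sv (or_introl vN) E; first by left.
  by right; exists j; [lia|left].
have [|->|[j ji ->]] := gen_section_neq (esym sv) _ E.
- by right; rewrite -sv.
- by left.
by right; exists j; [lia|right].
Qed.

(** While the prefix is not 0^k, [step_section] turns each step into one of degree m on the tail. *)
Lemma walk_first_visit m n v v' y y' : size v = size v' ->
  walk (step m.+1) n (wapp v y) (wapp v' y') ->
  walk (step m) n y y' \/
  exists n1 n2 y1, [/\ n1 + n2 = n, walk (step m) n1 y y1 &
    walk (step m.+1) n2 (wapp (zeros (size v)) y1) (wapp v' y')].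
Proof.
elim: n v y => [|n IH] v y sv.
  by move=> /(wapp_inj sv)[_ <-]; left.
have [{1}-> W|vN [x vx W]] := eqVneq v (zeros (size v)).
  by right; exists 0, n.+1, y.
have [v1 [y1 [sv1 xE]]] := wappE (size v) x; rewrite xE in vx W.
have yy1 := step_section (esym sv1) vN vx.
have [|W'|[n1 [n2 [y2 [<- W1 W2]]]]] := IH v1 y1 _ W; first by rewrite sv1.
  by left; exists y1.
right; exists n1.+1, n2, y2; rewrite addSn -sv1; split => //.
by exists y1.
Qed.

(** The last visit is the first visit of the reversed walk. *)
Lemma walk_last_visit m n k v' y y' : size v' = k ->
  walk (step m.+1) n (wapp (zeros k) y) (wapp v' y') ->
  exists n1 n2 y1, [/\ n1 + n2 = n,
    walk (step m.+1) n1 (wapp (zeros k) y) (wapp (zeros k) y1) &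
    walk (step m) n2 y1 y'].
Proof.
move=> sv' /(walk_sym (@step_sym _)) /walk_first_visit[|W|].
- by rewrite size_zeros.
- exists 0, n, y; split => //.
  exact: walk_sym (@step_sym _) W.
move=> [n1 [n2 [y1 [<- W1 W2]]]]; exists n2, n1, y1; split; first exact: addnC.
  by rewrite -sv'; rewrite sv' in W2 *; apply: walk_sym (@step_sym _) W2.
exact: walk_sym (@step_sym _) W1.
Qed.

(** * The upper bound *)

(* A loop of length at most n at the prefix 0^k acts on the tail in the same
   way as some walk that never leaves 0^k. *)
Definition tame m n k := forall n' y y', n' <= n ->
  walk (step m) n' (wapp (zeros k) y) (wapp (zeros k) y') ->
  walk (pstep m) n' y y'.

(** a_0 changes the one-letter prefix 0, and every other generator keeps it and acts on the tail as
    itself. *)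
Lemma tame1 m : tame m 1 1.
Proof.
case=> [y y' _ /wcons_inj[_ ->] //|[|//]] y y' _ /= [z S zE].
apply: walk1; move: S; rewrite zE; case => [/wcons_inj[_ ->]|[[|i] im]].
- by left.
- by rewrite /zeros /= !gen0_0; case=> /wcons_inj[].
- rewrite /zeros /= !genS_0.
  by case=> /wcons_inj[_ E]; right; exists i => //; [left|right].
Qed.

(* Cut the loop of length at most 2n in the middle. The two halves are short
   enough for their loops at 0^k to be tame, so that they leave the prefix
   0^(k+j) in place. Between the last visit to 0^k in the first half and the
   first visit in the second one, the tail performs a loop at 0^j in the graph
   of degree m. *)
Lemma tame_double m n k j : tame m.+1 n k -> tame m n.*2 j ->
  tame m.+1 n.*2 (k + j).
Proof.
move=> Tk Tj n' y y' n'2; rewrite zeros_cat !wapp_cat => W.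
have [n'n|nn'] := leqP n' n.
  have [z] := walk_pstep_zeros (Tk _ _ _ n'n W).
  by move=> /(wapp_inj erefl)[_ ->].
have n'E := subnKC (ltnW nn'); rewrite -n'E in W.
have [x W1 W2] := walk_split W.
have [v [u [sv xE]]] := wappE k x; rewrite xE in W1 W2.
have [n1 [n2 [y1 [n12 W11 W12]]]] := walk_last_visit sv W1.
have [n3 [n4 [y2 [n34 W22 W21]]]] :=
  walk_last_visit sv (walk_sym (@step_sym _) W2).
have n1n : n1 <= n by lia.
have n3n : n3 <= n by lia.
have [z1 z1E P1] := walk_pstep_zeros (Tk _ _ _ n1n W11).
have [z2 z2E P2] := walk_pstep_zeros (Tk _ _ _ n3n W22).
subst y1 y2.
have := walk_cat W12 (walk_sym (@step_sym _) W21).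
move=> /Tj-/(_ ltac:(lia)) P3.
have -> : n' = n1 + (n2 + n4 + n3) by lia.
apply: walk_cat P1 _; apply: walk_cat (walk_sym (@pstep_sym _) P2).
exact: walk_sub (@pstepW _) P3.
Qed.

(** Inverse steps are moved to the other side of the equation, as all powers of the adding machine
    commute. *)
Lemma walk_step0 n x z : walk (step 0) n x z ->
  exists a b, a + b <= n /\ iter a (gen 0) x = iter b (gen 0) z.
Proof.
elim: n x => [x ->|n IH x [y xy /IH[a [b [abn E]]]]]; first by exists 0, 0.
case: xy => [->|[i]]; first by exists a, b; split => //; apply: leqW.
rewrite leqn0 => /eqP -> [xy|yx].
- by exists a.+1, b; rewrite addSn iterSr xy.
- by exists a, b.+1; rewrite addnS -yx -iterSr !iterS E.
Qed.

Lemma iter_gen0_double b c w :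
  iter b.*2 (gen 0) (wcons c w) = wcons c (iter b (gen 0) w).
Proof.
elim: b => //= b ->.
by case: c; rewrite ?(gen0_0, gen0_1) // (gen0_1, gen0_0).
Qed.

(** [v] is the binary expansion of [b], lowest digit first; no carry reaches the tail. *)
Lemma iter_gen0_zeros k b : b < 2 ^ k ->
  exists2 v, size v = k &
    forall y, iter b (gen 0) (wapp (zeros k) y) = wapp v y.
Proof.
elim: k b => [|k IH] b bk.
  by exists [::] => // y; move: bk; rewrite expn0 ltnS leqn0 => /eqP ->.
have [|v sv vE] := IH b./2.
  by rewrite expnS in bk; lia.
exists (odd b :: v) => [|y]; first by rewrite /= sv.
rewrite -[in LHS](odd_double_half b) iterD [zeros _.+1]/= /= iter_gen0_double.
by rewrite vE; case: (odd b) => //=; rewrite gen0_0.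
Qed.

(** At most n < 2^k additions on each side produce no carry into the tail, so the loop fixes it. *)
Lemma tame0 n k : n < 2 ^ k -> tame 0 n k.
Proof.
move=> nk n' y y' n'n /walk_step0[a [b [abn]]].
have [|v sv ->] := @iter_gen0_zeros k a; first lia.
have [|v' sv' ->] := @iter_gen0_zeros k b; first lia.
move=> /wapp_inj[|_ ->]; first by rewrite sv'.
exact: walk_refl (@pstep_refl _).
Qed.

Lemma tame_pow2 m s : exists2 k, k <= s.+1 ^ m.+1 & tame m (2 ^ s) k.
Proof.
elim: m s => [|m IHm] s.
  by exists s.+1; [rewrite expn1|apply: tame0; rewrite ltn_exp2l].
elim: s => [|s [k ks Tk]].
  by exists 1; [rewrite exp1n|exact: tame1].
have [j js Tj] := IHm s.+1.
exists (k + j); last first.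
  by rewrite expnS mul2n in Tj *; exact: tame_double.
(* (s+2)^(m+2) = (s+2)^(m+1) + (s+1)(s+2)^(m+1): the first term bounds [j], the second one [k]. *)
rewrite [in leqRHS]expnS mulSn addnC.
apply: leq_add js _; apply: leq_trans ks _.
by rewrite expnS leq_mul // leq_exp2r.
Qed.

(** * Counting the endpoints of walks *)

Definition covers (Q : word -> word -> Prop) F :=
  forall x, exists s : seq word, size s <= F /\ forall z, Q x z -> z \in s.

Lemma covers_sub Q Q' F F' : (forall x z, Q x z -> Q' x z) -> F' <= F ->
  covers Q' F' -> covers Q F.
Proof.
move=> QQ' FF' C x; have [s [sF sP]] := C x.
by exists s; split=> [|z /QQ' /sP //]; exact: leq_trans sF FF'.
Qed.

Lemma covers_comp Q1 Q2 F1 F2 : covers Q1 F1 -> covers Q2 F2 ->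
  covers (fun x z => exists2 y, Q1 x y & Q2 y z) (F1 * F2).
Proof.
move=> C1 /boolp.choice[f fP] x; have [s [sF sP]] := C1 x.
exists (flatten (map f s)); split.
  apply: leq_trans (_ : size s * F2 <= _); last by rewrite leq_mul2r sF orbT.
  elim: s {sF sP} => //= y s IH; rewrite size_cat mulSn leq_add //.
  exact: (fP y).1.
move=> z [y xy yz]; apply/flatten_mapP; exists y; first exact: sP.
exact: (fP y).2.
Qed.

Lemma covers_prefix Q F k : covers Q F ->
  covers (fun x z => exists v v' y y', [/\ size v = k, size v' = k,
    x = wapp v y, z = wapp v' y' & Q y y']) (2 ^ k * F).
Proof.
move=> C x; have [v [y [sv ->]]] := wappE k x.
have [s [sF sP]] := C y.
exists [seq wapp (u : k.-tuple bool) y | u <- enum {: k.-tuple bool}, y <- s].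
split.
  by rewrite size_allpairs -cardE card_tuple card_bool leq_mul2l sF orbT.
move=> z [v1 [v' [y1 [y' [sv1 sv' E -> yy']]]]].
have [_ yE] := wapp_inj (etrans sv (esym sv1)) E; rewrite -yE in yy'.
have sv'P : size v' == k by rewrite sv'.
apply/allpairsP; exists (Tuple sv'P, y'); split => //=.
  exact: mem_enum.
exact: sP.
Qed.

Lemma gen_inj i : injective (gen i).
Proof. by rewrite -(a_gen (ord_max : 'I_i.+1)); exact: act_inj. Qed.

Lemma covers_step0 n : covers (walk (step 0) n) (n.+1 ^ 2).
Proof.
move=> x; pose g' := unact (Some (ord0 : 'I_1)).
have g'K : cancel (gen 0) g'.
  by rewrite -(a_gen (ord0 : 'I_1)); exact: actK.
exists [seq iter b g' (iter a (gen 0) x) | a <- iota 0 n.+1, b <- iota 0 n.+1].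
split; first by rewrite size_allpairs size_iota mulnn.
move=> z /walk_step0[a [b [abn E]]].
apply/allpairsP; exists (a, b); rewrite !mem_iota /= E; split; try lia.
by elim: b {abn E} z => //= b IH z; rewrite -iterS iterSr /= g'K.
Qed.

(** The zero word has no tail beyond a first 1; it is treated apart, being fixed by every
    a_(i+1). *)
Lemma zeros_or_one (x : word) : x = (fun=> false) \/
  exists l y, x = wapp (rcons (zeros l) true) y.
Proof.
have [[n xn]|N] := pselect (exists n, x n); last first.
  by left; apply/funext => n; apply/negP => xn; apply: N; exists n.
right; elim: n x xn => [|n IH] x xn.
  by exists 0, (fun k => x k.+1); apply/funext => -[|k] //=.
case x0 : (x 0).
  by exists 0, (fun k => x k.+1); apply/funext => -[].
have [l [y E]] := IH (fun k => x k.+1) xn.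
by exists l.+1, y; rewrite /= -E; apply/funext => -[].
Qed.

Lemma genS_zeros_one i l y : gen i.+1 (wapp (rcons (zeros l) true) y) =
  wapp (rcons (zeros l) true) (gen i y).
Proof. by elim: l => [|l IH] /=; rewrite ?genS_1 // genS_0 IH. Qed.

Lemma genS_false i : gen i.+1 (fun=> false) = (fun=> false).
Proof.
apply/funext => n; rewrite /gen.
suff -> : st i.+1 (fun=> false) n = Some i.+1 by [].
by elim: n => //= n ->.
Qed.

Lemma pstep_false m z : pstep m (fun=> false) z -> z = (fun=> false).
Proof.
case=> [//|[i _ [<-|E]]]; first exact: genS_false.
by apply: (@gen_inj i.+1); rewrite E genS_false.
Qed.

Lemma pstep_zeros_one m l y z : pstep m.+1 (wapp (rcons (zeros l) true) y) z ->
  exists2 y', z = wapp (rcons (zeros l) true) y' & step m y y'.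
Proof.
case=> [<-|[i im [<-|E]]]; first by exists y => //; left.
  by exists (gen i y); rewrite ?genS_zeros_one //; right; exists i; auto.
(* For an inverse generator, [z] is not the zero word, which is fixed, and its first 1 is in the
   same place, as a_(i+1) copies everything up to it. *)
have [zE|[l' [y' zE]]] := zeros_or_one z; rewrite zE in E *.
  exfalso; move: E; rewrite genS_false => /(congr1 (@^~ l)); clear.
  by elim: l => //= l IH; exact: IH.
move: E; rewrite genS_zeros_one => E.
have ll' : l' = l.
  by elim: l l' {zE} E => [|l IH] [|l'] //= /wcons_inj[// _ /IH ->].
subst l'; move: E => /(wapp_inj erefl)[_ <-].
by exists y' => //; right; exists i; auto.
Qed.

(* Beyond the first 1, the generators a_1, ..., a_(m+1) act as a_0, ..., a_m. *)
Lemma covers_pstep m n F : 0 < F -> covers (walk (step m) n) F ->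
  covers (walk (pstep m.+1) n) F.
Proof.
move=> F0 C x; have [->|[l [y ->]]] := zeros_or_one x.
  exists [:: fun=> false]; split => // z W; rewrite inE; apply/eqP.
  elim: n W {C} => [<- //|n IH [y /pstep_false -> /IH //]].
have [s [sF sP]] := C y.
exists [seq wapp (rcons (zeros l) true) u | u <- s]; rewrite size_map.
split => // z W.
suff [y' -> /sP ys] : exists2 y', z = wapp (rcons (zeros l) true) y' &
  walk (step m) n y y' by exact: map_f.
elim: n y W {C sP} => [y <-|n IH y [u /pstep_zeros_one[y1 -> yy1] /IH[y' -> W]]].
  by exists y.
by exists y' => //; exists y1.
Qed.

Lemma covers_stepS m n k F : 0 < F -> tame m.+1 n k ->
  covers (walk (step m) n) F -> covers (walk (step m.+1) n) (2 ^ k * F ^ 3).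
Proof.
move=> F0 Tk C; have C' := covers_pstep F0 C.
have := covers_prefix k (covers_comp C (covers_comp C' C)).
apply: covers_sub => // x z.
have [v [y [sv ->]]] := wappE k x; have [v' [y' [sv' ->]]] := wappE k z => W.
exists v, v', y, y'; split=> //.
have svv' := etrans sv (esym sv').
have [W1|[n1 [n2 [y1 [n12 W1 W2]]]]] := walk_first_visit svv' W.
  (* A walk that avoids 0^k is the first factor; the other two are padded by equality steps. *)
  exists y' => //; exists y'; apply: walk_refl.
    exact: pstep_refl.
  exact: step_refl.
rewrite sv in W2.
have [n3 [n4 [y2 [n34 W3 W4]]]] := walk_last_visit sv' W2.
have n3n : n3 <= n by lia.
have W5 := Tk _ _ _ n3n W3.
exists y1; first by apply: walk_leq W1; [exact: step_refl|lia].
exists y2; first by apply: walk_leq W5; [exact: pstep_refl|lia].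
by apply: walk_leq W4; [exact: step_refl|lia].
Qed.

Lemma covers_step_pow2 m : exists c, forall s,
  covers (walk (step m) (2 ^ s)) (2 ^ (c * s.+1 ^ m.+1)).
Proof.
elim: m => [|m [c IH]].
  exists 2 => s; apply: covers_sub (covers_step0 (2 ^ s)) => //.
  rewrite mulnC expnM leq_exp2r // expnS.
  by rewrite expn0 muln1 ltn_exp2l.
(* The 1 pays for the prefix factor 2^k of [covers_stepS], and 3c for the cube. *)
exists (1 + c * 3) => s.
have [k ks Tk] := tame_pow2 m.+1 s.
have := covers_stepS _ Tk (IH s); rewrite expn_gt0 => /(_ isT).
apply: covers_sub => //; rewrite -expnM -expnD leq_exp2l // mulnDl mul1n.
by apply: leq_add ks _; rewrite mulnAC leq_mul2l leq_pexp2l ?orbT.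
Qed.

(** * The lower bound *)

(* The action of a_i on prefixes. *)
Fixpoint fgen (i : nat) (v : seq bool) : seq bool :=
  if v is c :: v' then
    if i is j.+1 then c :: fgen (if c then j else i) v'
    else if c then false :: fgen 0 v' else true :: v'
  else [::].

Definition fstep m (v u : seq bool) : Prop :=
  v = u \/ exists2 i, i <= m & fgen i v = u.

Lemma fgen_wapp i v y : exists y', gen i (wapp v y) = wapp (fgen i v) y'.
Proof.
elim: v i => [|c v IH] [|i]; [by exists (gen 0 y)|by exists (gen i.+1 y)| |].
  case: c => /=; last by exists y; rewrite gen0_0.
  by have [y' E] := IH 0; exists y'; rewrite gen0_1 E.
case: c => /=.
  by have [y' E] := IH i; exists y'; rewrite genS_1 E.
by have [y' E] := IH i.+1; exists y'; rewrite genS_0 E.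
Qed.

Lemma walk_fstep_wapp m t v u y : walk (fstep m) t v u ->
  exists y', walk (step m) t (wapp v y) (wapp u y').
Proof.
elim: t v y => [v y ->|t IH v y [v1 S]]; first by exists y.
have [y1 S1] : exists y1, step m (wapp v y) (wapp v1 y1).
  case: S => [->|[i im <-]]; first by exists y; left.
  have [y1 E] := fgen_wapp i v y.
  by exists y1; right; exists i => //; left.
by move=> /IH-/(_ y1)[y' W]; exists y', (wapp v1 y1).
Qed.

Lemma size_fgen i v : size (fgen i v) = size v.
Proof. by elim: v i => [|[] v IH] [|i] //=; rewrite IH. Qed.

Lemma fgen_take i k v : fgen i (take k v) = take k (fgen i v).
Proof. by elim: v i k => [|[] v IH] [|i] [|k] //=; rewrite IH. Qed.

Lemma fgen_surj i z : exists2 y, size y = size z & fgen i y = z.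
Proof.
elim: z i => [|c z IH] i; first by exists [::].
case: i => [|i].
  case: c; first by exists (false :: z).
  by have [y sy E] := IH 0; exists (true :: y); rewrite /= ?sy ?E.
have [y sy E] := IH (if c then i else i.+1).
by exists (c :: y); rewrite /= ?sy ?E.
Qed.

Lemma fgen_cat i v z :
  exists2 y, size y = size z & fgen i (v ++ y) = fgen i v ++ z.
Proof.
elim: v i => [|c v IH] i; first exact: fgen_surj.
case: i => [|i] /=.
  case: c; last by exists z.
  by have [y sy E] := IH 0; exists y; rewrite // E.
by have [y sy E] := IH (if c then i else i.+1); exists y; rewrite // E.
Qed.

(** The tail is prescribed at the end of the walk and pulled back by surjectivity; in
    [walk_fstep_catr] it is prescribed at the start and pushed forward. *)
Lemma walk_fstep_catl m t v u z : walk (fstep m) t v u ->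
  exists2 y, size y = size z & walk (fstep m) t (v ++ y) (u ++ z).
Proof.
elim: t v => [v ->|t IH v [v1 S /IH[y1 sy1 W]]]; first by exists z.
case: S => [->|[i im E]].
  by exists y1 => //; exists (v1 ++ y1) => //; left.
have [y sy E'] := fgen_cat i v y1.
exists y; first by rewrite sy.
by exists (v1 ++ y1) => //; right; exists i; rewrite // E' E.
Qed.

Lemma walk_fstep_take m t k v u : walk (fstep m) t v u ->
  walk (fstep m) t (take k v) (take k u).
Proof.
apply: walk_map => {}v {}u [->|[i im <-]]; first by left.
by right; exists i; rewrite // fgen_take.
Qed.

Lemma walk_fstep_catr m t v u y : walk (fstep m) t v u ->
  exists2 z, size z = size y & walk (fstep m) t (v ++ y) (u ++ z).
Proof.
elim: t v y => [v y ->|t IH v y [v1 S]]; first by exists y.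
have [y1 sy1 S1] : exists2 y1, size y1 = size y &
    fstep m (v ++ y) (v1 ++ y1).
  case: S => [->|[i im <-]]; first by exists y => //; left.
  exists (drop (size v) (fgen i (v ++ y))).
    by rewrite size_drop size_fgen size_cat addKn.
  right; exists i => //; rewrite -[LHS](cat_take_drop (size v)) -fgen_take.
  by rewrite take_size_cat.
move=> /IH-/(_ y1)[z sz W]; exists z; first by rewrite sz.
by exists (v1 ++ y1).
Qed.

(* A diameter bound for the level [k] Schreier graph, without the inverses of
   the generators. *)
Definition conn m k t := forall v u, size v = k -> size u = k ->
  walk (fstep m) t v u.

(** Truncation makes level k' a quotient of level k, and equality steps pad the walks. *)
Lemma conn_leq m k k' t t' : k' <= k -> t <= t' -> conn m k t -> conn m k' t'.
Proof.
move=> kk' tt' C v u sv su.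
have sz w : size w = k' -> size (w ++ zeros (k - k')) = k.
  by move=> sw; rewrite size_cat sw size_zeros subnKC.
have := walk_fstep_take k' (C _ _ (sz v sv) (sz u su)).
by rewrite !take_size_cat //; apply: walk_leq => // w; left.
Qed.

Lemma fgenS_zeros_one i l y : fgen i.+1 (rcons (zeros l) true ++ y) =
  rcons (zeros l) true ++ fgen i y.
Proof. by elim: l => [|l IH] //=; rewrite IH. Qed.

Lemma conn_add m k j t t' : conn m.+1 k.+1 t -> conn m j t' ->
  conn m.+1 (k.+1 + j) (t + (t' + t)).
Proof.
move=> C C' v u sv su.
rewrite -(cat_take_drop k.+1 v) -(cat_take_drop k.+1 u).
set p := rcons (zeros k) true.
have sp : size p = k.+1 by rewrite size_rcons size_zeros.
have szt (w : seq bool) : size w = k.+1 + j -> size (take k.+1 w) = k.+1.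
  by move=> sw; rewrite size_takel // sw leq_addr.
have szd (w : seq bool) : size w = k.+1 + j -> size (drop k.+1 w) = j.
  by move=> sw; rewrite size_drop sw addKn.
(* The outer legs turn the two tails into [y1] and [y2]; the middle leg joins these behind the fixed
   prefix [p]. *)
have [y1 sy1 W1] := walk_fstep_catr (drop k.+1 v) (C _ p (szt v sv) sp).
have [y2 sy2 W2] := walk_fstep_catl (drop k.+1 u) (C p _ sp (szt u su)).
apply: walk_cat W1 _; apply: walk_cat W2.
have := C' y1 y2 (etrans sy1 (szd v sv)) (etrans sy2 (szd u su)).
apply: walk_map => y z [->|[i im <-]]; first by left.
by right; exists i.+1; rewrite // fgenS_zeros_one.
Qed.

(** The length solves T_(i+1) = 2 T_i + t with T_0 = 1, the recurrence given by [conn_add]. *)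
Lemma conn_mul m i j t : conn m j t ->
  conn m.+1 (i * j).+1 (2 ^ i * t.+1 - t).
Proof.
move=> C; elim: i => [|i IH].
  rewrite mul0n expn0 mul1n subSnn => -[|c []]// [|c' []]// _ _.
  apply: walk1; have [<-|cc'] := eqVneq c c'; first by left.
  by right; exists 0 => //; move: c c' cc' => [] [].
have -> : (i.+1 * j).+1 = (i * j).+1 + j by rewrite mulSn addSn addnC.
have -> : 2 ^ i.+1 * t.+1 - t =
    (2 ^ i * t.+1 - t) + (t + (2 ^ i * t.+1 - t)).
  rewrite expnS -mulnA.
  have : t.+1 <= 2 ^ i * t.+1 by rewrite leq_pmull // expn_gt0.
  lia.
exact: conn_add.
Qed.

(** Two additions of 1 act as one on the tail and keep the first letter; one more addition corrects
    that letter if necessary. *)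
Lemma conn0 k : conn 0 k (2 ^ k).-1.
Proof.
have S0 v : fstep 0 v (fgen 0 v) by right; exists 0.
elim: k => [[]// []//|k IH] [//|c v] [//|c' u] [sv] [su].
have W2 b v1 u1 t : walk (fstep 0) t v1 u1 ->
    walk (fstep 0) t.*2 (b :: v1) (b :: u1).
  elim: t v1 => [v1 -> //|t IHt v1 [v2 S /IHt W]].
  case: S => [->|[i]]; first by exists (b :: v2); [left|exists (b :: v2); [left|]].
  rewrite leqn0 => /eqP -> E; rewrite doubleS.
  exists (fgen 0 (b :: v1)) => //; exists (b :: v2) => //.
  by right; exists 0 => //; case: (b) => /=; rewrite E.
have tE : (2 ^ k.+1).-1 = (2 ^ k).-1.*2.+1.
  by rewrite expnS; have : 0 < 2 ^ k; rewrite ?expn_gt0; lia.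
rewrite tE; have [<-|cc'] := eqVneq c c'.
  by exists (c :: v); [left|exact/W2/IH].
exists (fgen 0 (c :: v)) => //.
case: c c' cc' => [] [] //= _; apply/W2/IH => //.
by rewrite size_fgen.
Qed.

Lemma conn_pow m s : conn m (s ^ m.+1) (2 ^ (m.+1 * s.+1)).
Proof.
elim: m => [|m IH].
  apply: conn_leq (conn0 (k := s)); first by rewrite expn1.
  by rewrite mul1n; apply: leq_trans (leq_pred _) _; rewrite leq_exp2l.
(* With t the bound for m, 2^s (t+1) <= 2^(s+1) t; this doubling is why the exponent contains
   s+1. *)
have := conn_mul (i := s) IH; apply: conn_leq; first by rewrite -expnS.
apply: leq_trans (leq_subr _ _) _.
rewrite [m.+2 * _]mulSn expnD [in leqRHS]expnS -mulnA mulnCA leq_mul2l.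
apply/orP; right; have : 0 < 2 ^ (m.+1 * s.+1) by rewrite expn_gt0.
lia.
Qed.

(** * Balls in the orbital Schreier graphs *)

Lemma step_a m (x y : word) :
  step m x y <-> x = y \/ exists i : 'I_m.+1, a_ i x = y \/ a_ i y = x.
Proof.
split=> -[->|[i]]; [by left| |by left|].
  move=> im E; right; exists (inord i : 'I_m.+1).
  by rewrite !a_gen inordK.
rewrite a_gen => E; right; exists i => //.
by have := ltn_ord i.
Qed.

Lemma vertices_step m w x y : vertices (schreier m w) x -> step m x y ->
  vertices (schreier m w) y.
Proof.
move=> [g Gg gw] /step_a[<-|[i E]]; first by exists g.
have Gi : generated (@generators m) (a_ i) by apply: generated_gen; exists i.
case: E => [<-|yx].
  by exists (a_ i \o g); [exact: generated_comp|rewrite /= gw].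
exists (unact (Some i) \o g).
  apply: generated_comp => //.
  by apply: generated_inv Gi _ _; [exact: actK|exact: unactK].
by rewrite /= gw -yx; exact: actK.
Qed.

Lemma adjacent_step m w x y : Defs.adjacent (schreier m w) x y -> step m x y.
Proof.
move=> /schreier_adjacentP[i E]; apply/step_a; right; exists i.
by case: E => [|<-]; [right|left; exact: unactK].
Qed.

Lemma step_adjacent m w x y : step m x y ->
  x = y \/ Defs.adjacent (schreier m w) x y.
Proof.
move=> /step_a[->|[i E]]; [by left|right].
apply/schreier_adjacentP; exists i; case: E => [<-|]; [right|by left].
exact: actK.
Qed.

Lemma ballE m w v n : vertices (schreier m w) v ->
  closed_ball_graph (schreier m w) v n = [set u | walk (step m) n v u].
Proof.
move=> Vv; apply/seteqP; split=> u /=.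
  move=> [p [vp _ <- pn]]; apply: walk_leq pn _; first exact: step_refl.
  elim: p v {Vv} vp => //= x p IH v /andP[/asboolP/(@adjacent_step m w) vx /IH W].
  by exists x.
elim: n v Vv => [v Vv <-|n IH v Vv [x vx]].
  by exists [::]; split => // -[].
have Vx := vertices_step Vv vx.
case: (step_adjacent w vx) => [<-|{}vx].
  by move=> /(IH _ Vv)[p [vp Vp pu pn]]; exists p; split => //; exact: leqW.
move=> /(IH _ Vx)[p [xp Vp pu pn]]; exists (x :: p); split => //=.
  by rewrite xp andbT; apply/asboolP.
move=> [|i] //= ip; have := Vp i ip.
by rewrite (set_nth_default v).
Qed.

Lemma growth_leq m w v n n' : vertices (schreier m w) v -> n <= n' ->
  growth_function (schreier m w) v n <= growth_function (schreier m w) v n'.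
Proof.
move=> Vv nn'; rewrite /growth_function; apply: fsubset_leq_card.
apply/fsubsetP => u; rewrite !in_fset_set; try exact: finite_ball_schreier.
rewrite !ballE // => /set_mem W; apply/mem_set.
exact: walk_leq (@step_refl m) nn' W.
Qed.

Lemma growth_upper m : exists c, forall w v, vertices (schreier m w) v ->
  forall s, growth_function (schreier m w) v (2 ^ s) <= 2 ^ (c * s.+1 ^ m.+1).
Proof.
have [c C] := covers_step_pow2 m; exists c => w v Vv s.
have [l [sl lP]] := C s v; apply: leq_trans sl.
apply: uniq_leq_size; first exact: fset_uniq.
move=> u; rewrite in_fset_set; last exact: finite_ball_schreier.
by rewrite ballE // => /set_mem; exact: lP.
Qed.

(** All 2^k prefixes of length k are reached from [v] in t steps, and distinct prefixes give
    distinct vertices. *)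
Lemma growth_lower m w v s : vertices (schreier m w) v ->
  2 ^ (s ^ m.+1) <= growth_function (schreier m w) v (2 ^ (m.+1 * s.+1)).
Proof.
move=> Vv; set k := s ^ m.+1; set t := 2 ^ (m.+1 * s.+1).
have [u [y [su vE]]] := wappE k v.
have /boolp.choice[f fP] (x : k.-tuple bool) :
    exists y', walk (step m) t v (wapp x y').
  rewrite vE; apply: walk_fstep_wapp.
  by apply: conn_pow; rewrite ?size_tuple.
have inj_f : injective (fun x : k.-tuple bool => wapp x (f x)).
  by move=> x x' /wapp_inj[|/val_inj]; rewrite ?size_tuple.
have -> : 2 ^ k =
    size [seq wapp (x : k.-tuple bool) (f x) | x <- enum {: k.-tuple bool}].
  by rewrite size_map -cardE card_tuple card_bool.
apply: uniq_leq_size; first by rewrite map_inj_uniq ?enum_uniq.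
move=> _ /mapP[x _ ->]; rewrite in_fset_set; last exact: finite_ball_schreier.
by rewrite ballE //; apply/mem_set; exact: fP.
Qed.

End Schreier.

(** * Comparison of growth functions *)

Section Asymptotics.
Local Open Scope ring_scope.
Variable R : realType.

Lemma nat_above (x : R) : exists2 C : nat, (0 < C)%N & x <= C%:R.
Proof.
exists (Num.truncn `|x|).+1 => //.
by apply: le_trans (ler_norm x) _; apply/ltW; exact: truncnS_gt.
Qed.

Lemma ln2_gt0 : 0 < ln 2 :> R.
Proof. by rewrite ln_gt0 // ltr1n. Qed.

Lemma explogE (A : R) m n : 0 < A ->
  explog A m n = expR (log2 R n ^+ m.+1 * ln A).
Proof. by move=> A0; rewrite /explog /powR gt_eqF. Qed.

Lemma log2_leq n t : (0 < t)%N -> (n <= 2 ^ t)%N -> log2 R n <= t%:R.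
Proof.
move=> t0 nt; rewrite /log2; case: ifPn => [_|]; first by rewrite ler1n.
rewrite -ltnNge => n1.
rewrite ler_pdivrMr ?ln2_gt0 // mulr_natl -lnXn ?ltr0n //.
by rewrite ler_ln ?posrE ?exprn_gt0 ?ltr0n ?(ltnW n1) // -natrX ler_nat.
Qed.

Lemma log2_geq n t : (0 < t)%N -> (2 ^ t <= n)%N -> t%:R <= log2 R n.
Proof.
move=> t0 tn; have n1 : (1 < n)%N.
  by apply: leq_trans tn; rewrite -(expn0 2) ltn_exp2l.
rewrite /log2 leqNgt n1 /=.
rewrite ler_pdivlMr ?ln2_gt0 // mulr_natl -lnXn ?ltr0n //.
by rewrite ler_ln ?posrE ?exprn_gt0 ?ltr0n ?(ltnW n1) // -natrX ler_nat.
Qed.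

Lemma log2_ge0 n : 0 <= log2 R n.
Proof.
rewrite /log2; case: ifPn => //; rewrite -ltnNge => n1.
by rewrite mulr_ge0 ?invr_ge0 ?(ltW ln2_gt0) ?ln_ge0 // ler1n ltnW.
Qed.

Lemma log2_pow2 s : (0 < s)%N -> log2 R (2 ^ s) = s%:R.
Proof. by move=> s0; apply/le_anti; rewrite log2_leq ?log2_geq. Qed.

(** The factor 2^c keeps the argument above 1, so that the convention for log 1 does not interfere
    at n = 1. *)
Lemma log2_mul_pow2 c n : (0 < c)%N -> (0 < n)%N ->
  log2 R (2 ^ c * n) = c%:R + ln n%:R / ln 2.
Proof.
move=> c0 n0; rewrite /log2 leqNgt.
have -> : (1 < 2 ^ c * n)%N.
  by rewrite (leq_trans _ (leq_pmulr _ n0)) // -(expn0 2) ltn_exp2l.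
rewrite /= natrM natrX lnM ?posrE ?exprn_gt0 ?ltr0n // lnXn ?ltr0n //.
by rewrite mulrDl -(mulr_natl (ln 2)) mulfK // gt_eqF // ln2_gt0.
Qed.

(** The bound ln x < x at x = n^(1/M), M = 2k+2, gives ln n <= M n^(1/M), and k/M <= 1/2. *)
Lemma log2_expn_sqrt k : exists2 K : R, 0 < K &
  forall n, (0 < n)%N -> log2 R n ^+ k <= K * Num.sqrt n%:R.
Proof.
pose M : R := k.*2.+2%:R.
have M0 : 0 < M by rewrite ltr0n.
(* The summand 1 covers n = 1, where the logarithm is 1 by convention. *)
exists (1 + (M / ln 2) ^+ k).
  by rewrite addr_gt0 // exprn_gt0 // divr_gt0 // ln2_gt0.
move=> n n0; have sn : 1 <= Num.sqrt n%:R :> R.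
  by rewrite -[leLHS]sqrtr1 ler_wsqrtr // ler1n.
rewrite /log2; case: ifPn => [_|n1].
  rewrite expr1n mulr_ege1 // lerDl exprn_ge0 // divr_ge0 ?ltW //.
  exact: ln2_gt0.
have nR : 0 < n%:R :> R by rewrite ltr0n.
have lnn : ln n%:R <= M * n%:R `^ M^-1.
  rewrite -ler_pdivrMl // -ln_powR ltW // ln_sublinear // powR_gt0 //.
have lnn0 : 0 <= ln n%:R :> R by rewrite ln_ge0 // ler1n.
rewrite mulrDl mul1r ler_wpDl ?sqrtr_ge0 //.
rewrite !exprMn [leRHS]mulrAC ler_wpM2r ?exprn_ge0 ?invr_ge0 ?(ltW ln2_gt0) //.
apply: (@le_trans _ _ ((M * n%:R `^ M^-1) ^+ k)).
  by rewrite lerXn2r ?nnegrE // mulr_ge0 ?powR_ge0 // ltW.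
rewrite exprMn ler_wpM2l ?exprn_ge0 ?(ltW M0) //.
rewrite -powR_mulrn ?powR_ge0 // -powRrM -powR12_sqrt ?(ltW nR) //.
rewrite ler_powR ?ler1n // ler_pdivrMl // -ler_pdivrMr ?invr_gt0 // invrK.
by rewrite -natrM ler_nat; lia.
Qed.

(** * Comparison with exponentials and polynomials *)

Lemma growth_le_trans (f g h : nat -> R) :
  growth_le f g -> growth_le g h -> growth_le f h.
Proof.
move=> [C C0 fg] [C' C'0 gh]; exists (C' * C)%N => [|n n0].
  by rewrite muln_gt0 C'0.
by apply: le_trans (fg _ n0) _; rewrite -mulnA gh // muln_gt0 C0.
Qed.

Lemma explog_le_exp (A : R) m a : 1 < A -> 1 < a ->
  growth_le (explog A m) (fun n => a ^+ n).
Proof.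
move=> A1 a1; have [K K0 KP] := log2_expn_sqrt m.+1.
have lnA : 0 < ln A by rewrite ln_gt0.
have lna : 0 < ln a by rewrite ln_gt0.
have [C C0 CP] := nat_above (K * ln A / ln a).
exists C => // n n0; rewrite explogE ?(lt_trans _ A1) //.
rewrite -[leRHS]lnK ?posrE ?exprn_gt0 ?(lt_trans _ a1) // ler_expR.
rewrite lnXn ?(lt_trans _ a1) // -mulr_natl natrM.
have nn : Num.sqrt n%:R <= n%:R :> R.
  rewrite -[leRHS]sqr_sqrtr // expr2 ler_peMl ?sqrtr_ge0 //.
  by rewrite -[leLHS]sqrtr1 ler_wsqrtr // ler1n.
rewrite ler_pdivrMr // in CP.
apply: (@le_trans _ _ (K * n%:R * ln A)).
  rewrite ler_wpM2r ?(ltW lnA) //; apply: le_trans (KP _ n0) _.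
  by rewrite ler_wpM2l // ltW.
by rewrite mulrAC [leRHS]mulrAC ler_wpM2r.
Qed.

Lemma not_exp_le_explog (A : R) m a : 1 < A -> 1 < a ->
  ~ growth_le (fun n => a ^+ n) (explog A m).
Proof.
move=> A1 a1 [C C0 H]; have [K K0 KP] := log2_expn_sqrt m.+1.
have lnA : 0 < ln A by rewrite ln_gt0.
have lna : 0 < ln a by rewrite ln_gt0.
(* At [N] the logarithms would give N ln a <= D sqrt(N) ln a, which fails once N > D^2. *)
pose D := K * Num.sqrt C%:R * ln A / ln a.
have [N N0 NP] := nat_above (D ^+ 2 + 1).
have := H N N0; rewrite explogE ?(lt_trans _ A1) //.
rewrite -[leLHS]lnK ?posrE ?exprn_gt0 ?(lt_trans _ a1) // ler_expR.
rewrite lnXn ?(lt_trans _ a1) // -mulr_natl.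
have CN : (0 < C * N)%N by rewrite muln_gt0 C0.
apply/negP; rewrite -ltNge.
apply: (@le_lt_trans _ _ (K * Num.sqrt (C * N)%:R * ln A)).
  by rewrite ler_wpM2r ?(ltW lnA) // KP.
have DE : K * Num.sqrt C%:R * ln A = D * ln a by rewrite divfK // gt_eqF.
rewrite natrM sqrtrM // mulrA mulrAC DE mulrAC ltr_pM2r //.
have N0' : 0 < Num.sqrt N%:R :> R by rewrite sqrtr_gt0 ltr0n.
rewrite -[ltRHS]sqr_sqrtr // expr2 ltr_pM2r //.
rewrite -[ltLHS]ger0_norm; last first.
  by rewrite !mulr_ge0 ?invr_ge0 ?sqrtr_ge0 // ltW.
rewrite -sqrtr_sqr ltr_sqrt ?ltr0n //.
by apply: lt_le_trans NP; rewrite ltrDl.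
Qed.

(** The exponent [size p] avoids a separate case for p = 0, and the summand 1 makes ln M
    nonnegative. *)
Lemma horner_natr_le (p : {poly R}) : exists2 M : R, 1 <= M &
  forall n, (0 < n)%N -> p.[n%:R] <= M * n%:R ^+ size p.
Proof.
exists (1 + \sum_(i < size p) `|p`_i|); first by rewrite lerDl sumr_ge0.
move=> n n0; rewrite horner_coef mulrDl mulr_suml.
apply: (@le_trans _ _ (\sum_(i < size p) `|p`_i| * n%:R ^+ size p)).
  apply: ler_sum => i _; apply: (@le_trans _ _ (`|p`_i| * n%:R ^+ i)).
    by rewrite ler_wpM2r ?exprn_ge0 // ler_norm.
  by rewrite ler_wpM2l // ler_weXn2l ?ler1n // ltnW.
by rewrite lerDr mul1r exprn_ge0.
Qed.

Lemma poly_le_explog (B : R) m (p : {poly R}) : 1 < B -> (0 < m)%N ->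
  growth_le (fun n => p.[n%:R]) (explog B m).
Proof.
move=> B1 m0; have [M M1 MP] := horner_natr_le p.
have lnB : 0 < ln B by rewrite ln_gt0.
have lnM0 : 0 <= ln M by rewrite ln_ge0.
(* With L = log n, the polynomial has logarithm at most E (1+L) <= c (1+L) ln B, and c (1+L) <=
   (c+L)^2 <= (c+L)^(m+1) as m >= 1; rescaling n by 2^c provides the shift of L by c. *)
pose E := ln M + (size p)%:R * ln 2.
have [c c0 cP] := nat_above (E / ln B).
exists (2 ^ c)%N => [|n n0]; first by rewrite expn_gt0.
apply: le_trans (MP _ n0) _.
have nR : 0 < n%:R :> R by rewrite ltr0n.
rewrite explogE ?(lt_trans _ B1) // log2_mul_pow2 //.
rewrite -[leLHS]lnK ?posrE ?mulr_gt0 ?exprn_gt0 ?(lt_le_trans _ M1) //.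
rewrite ler_expR lnM ?posrE ?exprn_gt0 ?(lt_le_trans _ M1) //.
rewrite lnXn // -[ln _ *+ _]mulr_natl.
set L := ln n%:R / ln 2.
have L0 : 0 <= L by rewrite divr_ge0 ?(ltW ln2_gt0) // ln_ge0 // ler1n.
have -> : ln n%:R = ln 2 * L by rewrite mulrC divfK // gt_eqF // ln2_gt0.
have c1 : 1 <= c%:R :> R by rewrite ler1n.
have cL1 : 1 <= c%:R + L by rewrite -[leLHS]addr0 lerD.
rewrite ler_pdivrMr // in cP.
apply: (@le_trans _ _ (E * (1 + L))).
  rewrite /E; have := ln2_gt0; have : 0 <= (size p)%:R :> R by [].
  move: (ln 2) (size p)%:R (ln M) lnM0 L0 => l e b; nra.
apply: (@le_trans _ _ (c%:R * (1 + L) * ln B)).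
  by rewrite [leRHS]mulrAC ler_wpM2r // addr_ge0.
rewrite ler_wpM2r ?(ltW lnB) //.
apply: (@le_trans _ _ ((c%:R + L) ^+ 2)).
  nra.
by rewrite ler_weXn2l.
Qed.

Lemma not_explog_le_poly (B : R) m (p : {poly R}) : 1 < B -> (0 < m)%N ->
  ~ growth_le (explog B m) (fun n => p.[n%:R]).
Proof.
move=> B1 m0 [C C0 H]; have [M M1 MP] := horner_natr_le p.
have lnB : 0 < ln B by rewrite ln_gt0.
set d := size p in MP.
have C1 : 1 <= C%:R :> R by rewrite ler1n.
pose M' := M * C%:R ^+ d.
have M'1 : 1 <= M' by rewrite mulr_ege1 // exprn_ege1.
have lnM' : 0 <= ln M' by rewrite ln_ge0.
(* At n = 2^s the logarithms are at least s^2 ln B and at most ln M' + s d ln 2; this [s] makes the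
   former larger. *)
have [s s0 sP] := nat_above ((ln M' + d%:R * ln 2 + 1) / ln B).
have s2 : (0 < 2 ^ s)%N by rewrite expn_gt0.
have Cs : (0 < C * 2 ^ s)%N by rewrite muln_gt0 C0.
have := le_trans (H _ s2) (MP _ Cs).
rewrite explogE ?(lt_trans _ B1) // log2_pow2 // natrM exprMn mulrA -/M'.
rewrite natrX -exprM.
have two0 : 0 < 2 :> R by [].
have M'0 : 0 < M' by rewrite (lt_le_trans _ M'1).
rewrite -[leRHS]lnK ?ler_expR; last by rewrite posrE mulr_gt0 ?exprn_gt0.
rewrite lnM ?posrE ?exprn_gt0 // lnXn // -[ln _ *+ _]mulr_natl natrM.
have s1 : 1 <= s%:R :> R by rewrite ler1n.
have sm : s%:R ^+ 2 <= s%:R ^+ m.+1 :> R by rewrite ler_weXn2l.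
rewrite ler_pdivrMr // in sP.
have sB : s%:R ^+ 2 * ln B <= s%:R ^+ m.+1 * ln B by rewrite ler_wpM2r // ltW.
have : s%:R * (ln M' + d%:R * ln 2 + 1) <= s%:R * (s%:R * ln B).
  by rewrite ler_wpM2l.
have : ln M' <= s%:R * ln M' by rewrite ler_peMl.
by rewrite mulrA -expr2; lra.
Qed.

Lemma intermediate_of_explog (A B : R) m gamma : (0 < m)%N -> 1 < A -> 1 < B ->
  growth_le (explog B m) gamma -> growth_le gamma (explog A m) ->
  intermediate gamma.
Proof.
move=> m0 A1 B1 Bg gA; split=> [p|a a1]; split.
- exact: growth_le_trans (poly_le_explog p B1 m0) Bg.
- by move=> [_ /(growth_le_trans Bg)]; exact: not_explog_le_poly.
- exact: growth_le_trans gA (explog_le_exp m A1 a1).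
- by move=> [_ /growth_le_trans/(_ gA)]; exact: not_exp_le_explog.
Qed.

End Asymptotics.

Theorem theorem6 (R : realType) (m : nat) (hm : (1 <= m)%N) :
  exists A B : R, [/\ B <= A, 1 < B &
    forall (w v : word), vertices (schreier m w) v ->
      let gamma := fun n : nat => (growth_function (schreier m w) v n)%:R : R in
      [/\ growth_le (explog B m) gamma,
          growth_le gamma (explog A m) &
          intermediate gamma]].
Proof.
have [c cP] := growth_upper m.
(* [growth_lower] gives 2^(s^(m+1)) vertices with s about log n / (m+1), whence B = 2^q. In A =
   2^(c+1) the 1 ensures A > 1 even if c = 0. *)
pose q : R := m.+1%:R^-1 ^+ m.+1.
pose A : R := 2 ^+ c.+1; pose B : R := expR (q * ln 2).
have l2 := ln2_gt0 R.
have q0 : 0 < q by rewrite exprn_gt0 // invr_gt0 ltr0n.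
have q1 : q <= 1 by rewrite exprn_ile1 ?invr_ge0 // invf_le1 ?ltr0n // ler1n.
have B1 : 1 < B by rewrite expR_gt1 mulr_gt0.
have lnA : ln A = c.+1%:R * ln 2 by rewrite lnXn // -[ln _ *+ _]mulr_natl.
have A1 : 1 < A by rewrite exprn_egt1 // ltr1n.
exists A, B; split => // [|w v Vv gamma].
  rewrite -[A]lnK ?posrE ?(lt_trans _ A1) // ler_expR lnA ler_wpM2r ?(ltW l2) //.
  by apply: le_trans q1 _; rewrite ler1n.
have Bgamma : growth_le (explog B m) gamma.
  exists (2 ^ m.+1.*2)%N => [|n n0]; first by rewrite expn_gt0.
  have /andP[tn nt] := trunc_log_bounds (ltnSn 1) n0; set t := trunc_log 2 n in tn nt.
  (* Rounding up gives log n <= t+1 <= (m+1)s, while (m+1)(s+1) <= 2(m+1) + t keeps the radius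
     within 2^(2(m+1)) n. *)
  pose s := (t %/ m.+1).+1.
  have ts : (t < m.+1 * s)%N by rewrite mulnC ltn_ceil.
  have st : (m.+1 * s.+1 <= m.+1.*2 + t)%N.
    rewrite !mulnS addnA addnn leq_add2l mulnC; exact: leq_trunc_div.
  apply: (@le_trans _ _ (2 ^ (s ^ m.+1))%:R); last first.
    rewrite ler_nat; apply: leq_trans (growth_lower s Vv) (growth_leq Vv _).
    by apply: leq_trans (leq_mul (leqnn _) tn); rewrite -expnD leq_exp2l.
  rewrite explogE ?expR_gt0 // expRK natrX -[leRHS]lnK ?posrE ?exprn_gt0 //.
  rewrite ler_expR lnXn // -[ln _ *+ _]mulr_natl natrX mulrA.
  rewrite ler_wpM2r ?(ltW l2) // -exprMn lerXn2r ?nnegrE //.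
    by rewrite mulr_ge0 ?invr_ge0 // log2_ge0.
  rewrite ler_pdivrMr ?ltr0n // -natrM log2_leq ?muln_gt0 // mulnC.
  by apply: leq_trans (ltnW nt) _; rewrite leq_exp2l.
have gammaA : growth_le gamma (explog A m).
  (* As n < 2^(t+1), [growth_upper] at t+1 involves t+2, and t+2 <= log(4n). *)
  exists 4 => // n n0; have /andP[tn nt] := trunc_log_bounds (ltnSn 1) n0.
  set t := trunc_log 2 n in tn nt.
  apply: (@le_trans _ _ (2 ^ (c * t.+2 ^ m.+1))%:R).
    rewrite ler_nat; apply: leq_trans (growth_leq Vv (ltnW nt)) _; exact: cP.
  rewrite explogE ?(lt_trans _ A1) // lnA natrX.
  rewrite -[leLHS]lnK ?posrE ?exprn_gt0 // ler_expR lnXn // -[ln _ *+ _]mulr_natl.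
  rewrite natrM natrX mulrA ler_wpM2r ?(ltW l2) // mulrC.
  have t2 : t.+2%:R <= log2 R (4 * n).
    by rewrite log2_geq // 2!expnS mulnA leq_mul2l tn.
  by rewrite ler_pM ?exprn_ge0 ?ler_nat // lerXn2r ?nnegrE // (le_trans _ t2).
by split => //; exact: intermediate_of_explog A1 B1 Bgamma gammaA.
Qed.
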